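(* Let $\mathcal{C}>0$, $R>0$, $G>0$ be hyperparameters. Consider the randomized algorithm NoisyHead (defined in the context) run on $N$ prompts with clipping parameter $\mathcal{C}$, projection parameters $R,G$, noise scale $\sigma$, privacy parameters $\varepsilon,\delta$, regularization parameter $\lambda$, step size $\eta_0$, $T$ iterations, and initialization $\Gamma^0$ with $\|\Gamma^0\|_F\le R$. If the noise scale satisfies $\sigma \ge 2G(\mathcal{C}+RG)$, then NoisyHead is in-context $(\varepsilon,\delta)$-differentially private.
   Context: Prompts. For $k\in[N]=\{1,\dots,N\}$, the $k$-th prompt $E_k$ consists of feature-response pairs $(x_{k,i},y_{k,i})$, $i=1,\dots,L+1$, with $x_{k,i}\in\mathbb{R}^D$, $y_{k,i}\in\mathbb{R}$, arranged as the matrix $E_k=\begin{pmatrix}x_{k,1}&\cdots&x_{k,L}&x_{k,L+1}\\ y_{k,1}&\cdots&y_{k,L}&0\end{pmatrix}\in\mathbb{R}^{(D+1)\times(L+1)}$; the pair $(x_{k,L+1},y_{k,L+1})$ is the query token, whose response $y_{k,L+1}$ is also available during training and is considered part of the $k$-th prompt. In-context differential privacy. A randomized algorithm $\mathcal{M}$ over sequences of prompts is in-context $(\varepsilon,\delta)$-differentially private if for any two sequences of prompts $\mathcal{D}=(E_1,\dots,E_N)$, $\mathcal{D}'=(E_1',\dots,E_N')$ differing in at most one entry, and all measurable subsets $\mathcal{W}$ of outputs, $\mathbb{P}[\mathcal{M}(\mathcal{D})\in\mathcal{W}]\le e^{\varepsilon}\,\mathbb{P}[\mathcal{M}(\mathcal{D}')\in\mathcal{W}]+\delta$.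 The probability is over the internal randomness of $\mathcal{M}$ only; $\mathcal{D},\mathcal{D}'$ are fixed. Operators. $\mathrm{clip}_{\mathcal{C}}(x)=\arg\min_{y\in[-\mathcal{C},\mathcal{C}]}|x-y|$ for $x\in\mathbb{R}$; for $r>0$, $\Pi_r(X)$ is the Frobenius-norm projection of a matrix $X$ onto $\{Y:\|Y\|_F\le r\}$. $\langle A,B\rangle=\operatorname{tr}(A^\top B)$. Algorithm NoisyHead. Input: prompts $(E_k)_{k\in[N]}$; noise scale $\sigma$; $\varepsilon,\delta$; $\mathcal{C}$; $R,G$; regularization parameter $\lambda\ge c>0$; number of iterations $T$; step size $\eta_0$; $\Gamma^0\in\mathbb{R}^{D\times D}$ with $\|\Gamma^0\|_F\le R$. (1) For $k\in[N]$ set $\widetilde Z_k=\Pi_G\big(L^{-1}x_{k,L+1}\sum_{i=1}^L \mathrm{clip}_{\mathcal{C}}(y_{k,i})\,x_{k,i}^\top\big)$. (2) For $t=0,\dots,T-1$: generate (independently) $z_t\in\mathbb{R}^{D\times D}$ with $\operatorname{vec}(z_t)\sim\mathcal{N}_{D^2}\big(0,\,2\eta_0^2\frac{T^2\sigma^2}{\varepsilon^2N^2}\log\frac{1.25T}{\delta}\,\mathbb{I}_{D^2}\big)$ and set $$\Gamma^{t+1}=\Pi_R\Big((1-2\lambda\eta_0)\Gamma^t-\frac{\eta_0}{N}\sum_{k=1}^N\big(\langle\Gamma^t,\widetilde Z_k\rangle-\mathrm{clip}_{\mathcal{C}}(y_{k,L+1})\big)\widetilde Z_k+z_t\Big).$$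 Output: $\hat\Gamma:=\Gamma^T$.
   Formalization: The theorem adds ε ≤ T (per-iteration budget at most 1), since without a bound on ε the claim fails (e.g. N=T=D=L=1, ε=100, δ=0.1); it also makes explicit ε>0, 0<δ<1, η₀>0 and N, L ≥ 1. *)

(* Defs.v *)
From HB Require Import structures.
From mathcomp Require Import all_boot all_order all_algebra.
From mathcomp Require Import all_classical all_reals all_analysis.

Set Implicit Arguments.
Unset Strict Implicit.
Unset Printing Implicit Defensive.

Import Order.TTheory GRing.Theory Num.Theory.
Import numFieldNormedType.Exports.

Local Open Scope classical_set_scope.
Local Open Scope ring_scope.

Definition argmin (R : realType) (E : pointedType) (f : E -> R) (A : set E) : E :=
  get [set y | A y /\ forall y', A y' -> f y <= f y'].

Definition clip (R : realType) (C x : R) : R :=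
  argmin (fun y : R => `|x - y|) `[- C, C].

Definition mxinner (R : realType) (m n : nat) (A B : 'M[R]_(m, n)) : R :=
  \tr (A^T *m B).

(* The norm [`|X|] that the library puts on matrices is the maximum norm. *)
Definition frobenius (R : realType) (m n : nat) (X : 'M[R]_(m, n)) : R :=
  Num.sqrt (mxinner X X).

Definition frobenius_proj (R : realType) (m n : nat) (r : R)
    (X : 'M[R]_(m, n)) : 'M[R]_(m, n) :=
  argmin (fun Y => frobenius (X - Y)) [set Y | frobenius Y <= r].

Definition borel_mx (R : realType) (m n : nat) : set (set 'M[R]_(m, n)) :=
  <<s [set U | open U] >>.

(* A prompt consists of the [L] context pairs, in columns [0 .. L-1], and the
   query pair, in the last column.  Unlike the matrix [E_k], which has a [0] in
   the corner, it contains the response of the query. *)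
Record prompt (R : realType) (D L : nat) := Prompt {
  features : 'M[R]_(D, L.+1);
  responses : 'rV[R]_(L.+1) }.

Section Prompt.
Variables (R : realType) (D L : nat) (E : prompt R D L).

Definition ctx_x (i : 'I_L) : 'cV[R]_D :=
  col (widen_ord (leqnSn L) i) (features E).
Definition ctx_y (i : 'I_L) : R := responses E 0 (widen_ord (leqnSn L) i).
Definition query_x : 'cV[R]_D := col ord_max (features E).
Definition query_y : R := responses E 0 ord_max.

End Prompt.

Definition prompts (R : realType) (D L N : nat) := 'I_N -> prompt R D L.

Definition neighbors (R : realType) (D L N : nat) (Ds Ds' : prompts R D L N) :
    Prop :=
  forall k l : 'I_N, Ds k <> Ds' k -> Ds l <> Ds' l -> k = l.

(* A randomized algorithm is a function of its input and of a sample point of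
   the probability space that carries its internal randomness; [SE] is the
   sigma-algebra on the outputs. *)
Definition in_context_dp (R : realType) (D L N : nat)
    (d : measure_display) (Omega : measurableType d) (P : probability Omega R)
    (E : Type) (SE : set (set E)) (M : prompts R D L N -> Omega -> E)
    (eps delta : R) : Prop :=
  forall Ds Ds' : prompts R D L N, neighbors Ds Ds' ->
  forall W : set E, SE W ->
  (P (M Ds @^-1` W) <= (expR eps)%:E * P (M Ds' @^-1` W) + delta%:E)%E.

Definition mutually_independent (R : realType)
    (d : measure_display) (Omega : measurableType d) (P : probability Omega R)
    (E : Type) (SE : set (set E)) (I : finType) (X : I -> Omega -> E) : Prop :=
  forall (J : {set I}) (A : I -> set E), (forall i, SE (A i)) ->
  P (\bigcap_(i in [set` J]) (X i @^-1` A i))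
    = (\prod_(i in J) P (X i @^-1` A i))%E.

(* [X] is distributed as N_n(0, v I_n), i.e. its coordinates are independent
   with law N(0, v); the second parameter of [normal_prob] is the standard
   deviation. *)
Definition isotropic_gaussian (R : realType)
    (d : measure_display) (Omega : measurableType d) (P : probability Omega R)
    (n : nat) (v : R) (X : Omega -> 'rV[R]_n) : Prop :=
  [/\ forall j, measurable_fun setT (fun w => X w 0 j),
      forall j (A : set R), measurable A ->
        P ((fun w => X w 0 j) @^-1` A) = normal_prob 0 (Num.sqrt v) A
    & mutually_independent P measurable (fun (j : 'I_n) w => X w 0 j)].

Section NoisyHead.
Variables (R : realType) (D L N T : nat).
Variables (sigma eps delta C r G lambda eta0 : R) (Gamma0 : 'M[R]_D).

Definition noise_variance : R :=
  2 * eta0 ^+ 2 * (T%:R ^+ 2 * sigma ^+ 2 / (eps ^+ 2 * N%:R ^+ 2))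
    * ln (5 / 4 * T%:R / delta).

Definition Ztilde (E : prompt R D L) : 'M[R]_D :=
  frobenius_proj G (L%:R^-1 *:
    (query_x E *m \sum_(i < L) clip C (ctx_y E i) *: (ctx_x E i)^T)).

Definition noisy_step (Ds : prompts R D L N) (Gamma z : 'M[R]_D) : 'M[R]_D :=
  frobenius_proj r ((1 - 2 * lambda * eta0) *: Gamma
    - (eta0 / N%:R) *: (\sum_(k < N)
        (mxinner Gamma (Ztilde (Ds k)) - clip C (query_y (Ds k)))
          *: Ztilde (Ds k))
    + z).

Fixpoint noisy_iter (Ds : prompts R D L N) (z : nat -> 'M[R]_D) (t : nat) :
    'M[R]_D :=
  if t is t'.+1 then noisy_step Ds (noisy_iter Ds z t') (z t') else Gamma0.

Definition noisy_head (Ds : prompts R D L N) (z : nat -> 'M[R]_D) : 'M[R]_D :=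
  noisy_iter Ds z T.

(* Only [z 0, ..., z T.-1] are used by [noisy_head]. *)
Definition noisy_head_noise
    (d : measure_display) (Omega : measurableType d) (P : probability Omega R)
    (z : nat -> Omega -> 'M[R]_D) : Prop :=
  (forall t : 'I_T,
     isotropic_gaussian P noise_variance (fun w => mxvec (z t w))) /\
  mutually_independent P (@borel_mx R D D) (fun (t : 'I_T) => z t).

End NoisyHead.

(* Main.v *)
Require Import Defs.
From HB Require Import structures.
From mathcomp Require Import all_boot all_order all_algebra.
From mathcomp Require Import all_classical all_reals all_analysis.
From mathcomp Require Import measurable_realfun ring lra.

Set Implicit Arguments.
Unset Strict Implicit.
Unset Printing Implicit Defensive.

Import Order.TTheory GRing.Theory Num.Theory.
Import numFieldNormedType.Exports.

Local Open Scope classical_set_scope.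
Local Open Scope ring_scope.

(* Two neighbouring datasets move the mean of an iteration by a vector [a] with
   |a| <= (eta0 / N) 2 G (C + r G), because a single summand changes and
   |Gamma| <= r, |Ztilde| <= G.  By the Cameron-Martin formula, shifting the noise
   by [a] multiplies its law by exp l, where l is the privacy loss; bounding the
   excess of exp l over exp eps by a multiple of exp (p l), whose expectation is
   explicit, gives the (eps/T, delta/T) bound without computing any Gaussian tail.
   A suitable p makes the multiple at most delta/T throughout
   0 < eps/T <= 1, 0 < delta/T < 1.  The bound is proved for all test functions
   with values in [0, 1] rather than for sets, which lets it be iterated over the
   T steps, the current iterate being independent of the noise to come. *)

Local Notation borel_mxType R m n :=
  (g_sigma_algebraType [set U : set 'M[R]_(m, n) | open U]).

(** * Borel sets of matrices *)

Definition mx_box (R : realType) (m n : nat) (A : 'I_m -> 'I_n -> set R) :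
    set 'M[R]_(m, n) :=
  [set M | forall i j, A i j (M i j)].

Definition mx_boxes (R : realType) (m n : nat) : set (set 'M[R]_(m, n)) :=
  [set B | exists2 A : 'I_m -> 'I_n -> set R,
    (forall i j, measurable (A i j)) & B = mx_box A].

Lemma setI_closed_mx_boxes (R : realType) (m n : nat) :
  setI_closed (@mx_boxes R m n).
Proof.
move=> _ _ [A mA ->] [B mB ->]; exists (fun i j => A i j `&` B i j).
  by move=> i j; exact: measurableI.
apply/seteqP; split => [M [MA MB] i j|M MAB]; first by split.
by split=> i j; have [] := MAB i j.
Qed.

Lemma mx_boxes_setT (R : realType) (m n : nat) : mx_boxes [set: 'M[R]_(m, n)].
Proof. by exists (fun _ _ => setT) => //; apply/seteqP; split. Qed.

Lemma mx_box_preimage (R : realType) (m n : nat) (T : Type)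
    (f : T -> 'M[R]_(m, n)) (A : 'I_m -> 'I_n -> set R) :
  f @^-1` mx_box A =
  \bigcap_(ij in [set: 'I_m * 'I_n]) ((fun w => f w ij.1 ij.2) @^-1` A ij.1 ij.2).
Proof.
apply/seteqP; split => w Aw; first by move=> [i j] _; exact: Aw.
by move=> i j; exact: (Aw (i, j)).
Qed.

Lemma measurable_mx_entry (R : realType) (m n : nat) (i : 'I_m) (j : 'I_n) :
  measurable_fun setT (fun M : borel_mxType R m n => M i j).
Proof.
apply: (measurability _ (RGenOpens.measurableE R)).
move=> _ [_ [a [b ->]] <-]; rewrite setTI; apply: sub_sigma_algebra => /=.
have /continuousP := @coord_continuous R m n i j.
by apply; exact: interval_open.
Qed.

(* An open set of matrices is the union of the boxes with rational centre and
   radius [1/(k+1)] that it contains. *)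
Lemma open_mx_boxes (R : realType) (m n : nat) (U : set 'M[R]_(m, n)) :
  open U -> <<s @mx_boxes R m n >> U.
Proof.
move=> oU.
pose A (c : 'M[rat]_(m, n) * nat) := fun (i : 'I_m) (j : 'I_n) =>
  ball (ratr (c.1 i j) : R) c.2.+1%:R^-1.
pose F c := if pselect (mx_box (A c) `<=` U) is left _ then mx_box (A c) else set0.
have -> : U = \bigcup_c F c.
  apply/seteqP; split => [M UM|M [c _]]; last first.
    by rewrite /F; case: pselect => // AU /AU.
  have /nbhs_ballP [e /= e0 eU] : nbhs M U by exact: open_nbhs_nbhs.
  (* Half of [e] is taken because [M] and a point of the box are each within [k.+1%:R^-1] of the
     rational centre, hence within twice that of each other. *)
  have [k ke] : exists k : nat, (k.+1%:R^-1 : R) < e / 2.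
    have e2 : 0 < e / 2 by rewrite divr_gt0.
    have := @near_infty_natSinv_lt R (PosNum e2).
    by case=> N _ /(_ N (leqnn _)); exists N.
  have /choice [q qM] : forall ij : 'I_m * 'I_n, exists q : rat,
      ball (ratr q : R) k.+1%:R^-1 (M ij.1 ij.2).
    move=> ij; have k0 : (0 : R) < k.+1%:R^-1 by rewrite invr_gt0.
    have /(@rat_in_itvoo R) [q] :
        M ij.1 ij.2 - k.+1%:R^-1 < M ij.1 ij.2 + k.+1%:R^-1.
      by rewrite ltrD2l (lt_trans _ k0)// oppr_lt0.
    rewrite in_itv /= => /andP[q1 q2]; exists q.
    have : ball (M ij.1 ij.2) k.+1%:R^-1 (ratr q) by rewrite ball_itv /= in_itv /= q1 q2.
    exact: ball_sym.
  pose c := (\matrix_(i, j) q (i, j), k).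
  have cU : mx_box (A c) `<=` U.
    move=> M' M'c; apply: eU; split => // i j.
    have := M'c i j; have := qM (i, j); rewrite /A /= mxE => /ball_sym Mq qM'.
    apply: (@le_ball _ _ _ (k.+1%:R^-1 + k.+1%:R^-1)); last exact: ball_triangle Mq qM'.
    by rewrite [e in _ <= e]splitr lerD// ltW.
  exists c => //; rewrite /F; case: pselect => // _ i j.
  by have := qM (i, j); rewrite /A /= mxE.
apply: (@countable_bigcupT_measurable _ (g_sigma_algebraType (@mx_boxes R m n))).
  exact: countableP.
move=> c; rewrite /F; case: pselect => // AU.
apply: sub_sigma_algebra; exists (A c) => // i j; exact: measurable_ball.
Qed.

(** Boxes are stable under intersection, so that independence can be tested on them, and they
    constrain the entries one by one, so that measurability can be tested entrywise. *)
Lemma borel_mxE (R : realType) (m n : nat) :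
  @borel_mx R m n = <<s @mx_boxes R m n >>.
Proof.
apply/seteqP; split.
  apply: smallest_sub; first exact: smallest_sigma_algebra.
  by move=> U; exact: open_mx_boxes.
apply: smallest_sub; first exact: smallest_sigma_algebra.
move=> _ [A mA ->].
have -> : mx_box A = id @^-1` mx_box A by [].
rewrite mx_box_preimage.
apply: (@fin_bigcap_measurable _ (borel_mxType R m n)); first exact: finite_finset.
move=> ij _; rewrite -[X in measurable X]setTI.
exact: measurable_mx_entry.
Qed.

Lemma measurable_mxP (R : realType) (m n : nat) (d : measure_display)
    (T : measurableType d) (f : T -> borel_mxType R m n) :
  measurable_fun setT f <->
  forall i j, measurable_fun setT (fun w => f w i j).
Proof.
split=> [mf i j|mf].
  exact: (measurableT_comp (measurable_mx_entry i j) mf).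
apply: (@measurability _ _ T (borel_mxType R m n) setT f _ (borel_mxE R m n)).
move=> _ [_ [A mA ->] <-]; rewrite setTI mx_box_preimage.
apply: fin_bigcap_measurable; first exact: finite_finset.
by move=> ij _; rewrite -[X in measurable X]setTI; exact: mf.
Qed.

(** * Densities and independence *)

Section Density.
Import HBNNSimple.

(** By monotone convergence both sides are limits along simple functions increasing to [f]; on a
    level set of a simple function the identity is the assumption on [nu]. *)
Lemma ge0_integral_density (R : realType) (d : measure_display)
    (T : measurableType d) (mu nu : {measure set T -> \bar R})
    (g : T -> R) (f : T -> \bar R) :
  measurable_fun setT g -> (forall x, 0 <= g x) ->
  (forall A, measurable A -> nu A = \int[mu]_(x in A) (g x)%:E)%E ->
  measurable_fun setT f -> (forall x, 0 <= f x)%E ->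
  (\int[nu]_x f x = \int[mu]_x (f x * (g x)%:E))%E.
Proof.
move=> mg g0 nuE mf f0.
pose h := nnsfun_approx measurableT mf.
have cvg_h x : EFin \o h ^~ x @ \oo --> f x by exact: cvg_nnsfun_approx.
have nd_h x : {homo (fun n => h n x) : a b / (a <= b)%N >-> a <= b}.
  by move=> a b ab; exact/lefP/nd_nnsfun_approx.
have mgE : measurable_fun setT (EFin \o g) by exact/measurable_EFinP.
transitivity (limn (fun n => \int[nu]_x (h n x)%:E)%E).
  rewrite -monotone_convergence//; last 3 first.
  - by move=> n; exact/measurable_EFinP.
  - by move=> n x _; rewrite lee_fin.
  - by move=> x _ a b ab; rewrite lee_fin nd_h.
  by apply: eq_integral => x _; apply/esym/cvg_lim => //; exact: cvg_h.
transitivity (limn (fun n => \int[mu]_x ((h n x)%:E * (g x)%:E))%E); last first.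
  rewrite -monotone_convergence//; last 3 first.
  - by move=> n; apply: emeasurable_funM => //; exact/measurable_EFinP.
  - by move=> n x _; rewrite -EFinM lee_fin mulr_ge0.
  - by move=> x _ a b ab; rewrite -!EFinM lee_fin ler_wpM2r// nd_h.
  apply: eq_integral => x _; apply/cvg_lim => //.
  by apply: cvgeZr => //; exact: cvg_h.
apply/congr_lim/funext => n.
have mI r : measurable_fun setT (fun x => (r * \1_(h n @^-1` [set r]) x)%:E : \bar R).
  by apply/measurable_EFinP; exact: measurable_funM.
transitivity (\int[nu]_x (\sum_(r \in range (h n))
    (r * \1_(h n @^-1` [set r]) x)%:E))%E.
  by apply: eq_integral => x _; rewrite fimfunE -fsumEFin.
rewrite ge0_integral_fsum//; last by move=> r x _; exact: nnfun_muleindic_ge0.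
transitivity (\int[mu]_x (\sum_(r \in range (h n))
    (r * \1_(h n @^-1` [set r]) x)%:E * (g x)%:E))%E; last first.
  apply: eq_integral => x _.
  rewrite -ge0_mule_fsuml => [|r]; last exact: nnfun_muleindic_ge0.
  by rewrite fsumEFin// -fimfunE.
rewrite ge0_integral_fsum//; last 2 first.
- by move=> r; exact: emeasurable_funM.
- move=> r x _; apply: mule_ge0; last by rewrite lee_fin.
  exact: nnfun_muleindic_ge0.
apply: eq_fsbigr => r _.
have mr : measurable (h n @^-1` [set r]) by [].
under [RHS]eq_integral do rewrite EFinM -muleA.
(* A scalar is pulled out of the integral only when nonnegative; for [r < 0] the level set of the
   nonnegative function [h n] is empty. *)
have [r0|r0] := leP 0 r; last first.
  have -> : h n @^-1` [set r] = set0.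
    apply/seteqP; split => // x /= hr.
    by move: r0; rewrite -hr ltNge fun_ge0.
  rewrite indic0; under eq_integral do rewrite mulr0.
  by under [RHS]eq_integral do rewrite mul0e mule0; rewrite !integral0.
under eq_integral do rewrite EFinM.
rewrite ge0_integralZl//; last exact/measurable_EFinP.
rewrite ge0_integralZl//; last 2 first.
- by apply: emeasurable_funM => //; exact/measurable_EFinP.
- by move=> x _; rewrite mule_ge0 ?lee_fin.
rewrite integral_indic// setIT nuE// integral_mkcond; congr (_ * _)%E.
apply: eq_integral => x _.
by rewrite epatch_indic muleC.
Qed.

End Density.

(** As functions of [B], both sides are finite measures: the image under [Y] of [P] restricted to
    [U], and the law of [Y] scaled by [P U]. They agree on a generating family closed under
    intersection, hence everywhere. *)
Lemma indep_generated (R : realType) (d d' : measure_display)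
    (Omega : measurableType d) (P : probability Omega R)
    (T : measurableType d') (Y : Omega -> T) (U : set Omega) (G : set (set T)) :
  measurable U -> measurable_fun setT Y ->
  measurable = <<s G >> -> setI_closed G -> G setT ->
  (forall B, G B -> P (U `&` Y @^-1` B) = P U * P (Y @^-1` B))%E ->
  forall B, measurable B -> (P (U `&` Y @^-1` B) = P U * P (Y @^-1` B))%E.
Proof.
move=> mU mY mG GI GT UG B mB.
have PU0 : 0 <= fine (P U) by exact: fine_ge0.
have PUE : (fine (P U))%:E = P U by rewrite fineK// fin_num_measure.
pose m1_ : {measure set T -> \bar R} := pushforward (mrestr P mU) Y.
pose m2_ : {measure set T -> \bar R} := mscale (NngNum PU0) (pushforward P Y).
pose m1 := m1_ mY; pose m2 := m2_ mY.
have m1E A : m1 A = P (U `&` Y @^-1` A) by rewrite setIC.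
have m2E A : m2 A = (P U * P (Y @^-1` A))%E by rewrite -PUE.
rewrite -m1E -m2E.
apply: (measure_unique G (fun=> setT)) => //; first by rewrite bigcup_const.
- by move=> A GA; rewrite m1E m2E UG.
- by move=> _; rewrite m1E preimage_setT setIT -ge0_fin_numE// fin_num_measure.
Qed.

(** Independence makes the law of the pair the product of the two laws; Tonelli's theorem then gives
    the iterated integral. *)
Lemma ge0_integral_indep (R : realType) (d d1 d2 : measure_display)
    (Omega : measurableType d) (P : probability Omega R)
    (T1 : measurableType d1) (T2 : measurableType d2)
    (X : Omega -> T1) (Y : Omega -> T2) (f : T1 * T2 -> \bar R) :
  measurable_fun setT X -> measurable_fun setT Y ->
  (forall A B, measurable A -> measurable B ->
    P (X @^-1` A `&` Y @^-1` B) = P (X @^-1` A) * P (Y @^-1` B))%E ->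
  measurable_fun setT f -> (forall u, 0 <= f u)%E ->
  (\int[P]_w f (X w, Y w) = \int[P]_w \int[P]_w' f (X w, Y w'))%E.
Proof.
move=> mX mY XY mf f0.
pose X' : {mfun Omega >-> T1} := HB.pack X (isMeasurableFun.Build _ _ _ _ _ mX).
pose Y' : {mfun Omega >-> T2} := HB.pack Y (isMeasurableFun.Build _ _ _ _ _ mY).
have mXY : measurable_fun setT (fun w => (X w, Y w)).
  exact: measurable_fun_pair.
pose XY' : {mfun Omega >-> (T1 * T2)%type} :=
  HB.pack (fun w => (X w, Y w)) (isMeasurableFun.Build _ _ _ _ _ mXY).
transitivity (\int[distribution P XY']_u f u)%E.
  by rewrite ge0_integral_distribution.
transitivity (\int[distribution P X' \x distribution P Y']_u f u)%E.
  apply: eq_measure_integral => A mA _; apply/esym.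
  apply: product_measure_unique => // B C mB mC.
rewrite fubini_tonelli1// ge0_integral_distribution//; last 2 first.
- exact: measurable_fun_fubini_tonelli_F.
- by move=> x; exact: integral_ge0.
apply: eq_integral => w _; rewrite /= /fubini_F ge0_integral_distribution//.
exact: measurableT_comp.
Qed.

(** * The Cameron-Martin formula *)

Lemma lebesgue_measure_shift (R : realType) (a : R) (A : set R) :
  measurable A -> lebesgue_measure [set x | A (x + a)] = lebesgue_measure A.
Proof.
move=> mA; have ma : measurable_fun [set: R] (fun x : R => x + a).
  exact: measurable_funD.
pose T := measurableTypeR R.
pose mu_ : {measure set T -> \bar R} :=
  @pushforward _ _ T T _ (@lebesgue_measure R) (fun x : R => x + a).
have := @lebesgue_measure_unique R (mu_ ma) _ A mA; move=> -> //.
move=> _ [[u v] /= _ <-]; rewrite /mu_ /= /pushforward.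
have -> : (fun x : R => x + a) @^-1` `]u, v] = `]u - a, v - a]%classic.
  by apply/seteqP; split => x /=; rewrite !in_itv /= ltrBlDr lerBrDr.
by rewrite !lebesgue_measure_itv /= !lte_fin ltrD2r -!EFinB opprB addrA subrK.
Qed.

Lemma ge0_integral_shift (R : realType) (a : R) (f : R -> \bar R) :
  measurable_fun setT f -> (forall x, 0 <= f x)%E ->
  (\int[lebesgue_measure]_x f (x + a)%R = \int[lebesgue_measure]_x f x)%E.
Proof.
move=> mf f0; have ma : measurable_fun [set: R] (fun x : R => x + a).
  exact: measurable_funD.
pose T := measurableTypeR R.
have <- := @ge0_integral_pushforward _ _ T T R _ ma lebesgue_measure setT f
  measurableT mf (fun x _ => f0 x).
by apply: eq_measure_integral => A mA _; exact: lebesgue_measure_shift.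
Qed.

Lemma normal_pdf_shift (R : realType) (s a x : R) : s != 0 ->
  normal_pdf 0 s (x - a) = expR ((a * x - a ^+ 2 / 2) / s ^+ 2) * normal_pdf 0 s x.
Proof.
move=> s0; rewrite !normal_pdfE// mulrCA; congr (_ * _).
by rewrite /normal_fun -expRD; congr expR; field.
Qed.

(** Translation invariance of Lebesgue measure moves the shift from [k] to the Gaussian density, and
    completing the square turns the shifted density into the original one times the exponential. *)
Lemma ge0_integral_normal_shift (R : realType) (d : measure_display)
    (Omega : measurableType d) (P : probability Omega R) (X : Omega -> R)
    (s a : R) (k : R -> \bar R) :
  s != 0 -> measurable_fun setT X ->
  (forall A, measurable A -> P (X @^-1` A) = normal_prob 0 s A) ->
  measurable_fun setT k -> (forall x, 0 <= k x)%E ->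
  (\int[P]_w k (X w + a)%R
   = \int[P]_w (k (X w) * (expR ((a * X w - a ^+ 2 / 2) / s ^+ 2))%:E))%E.
Proof.
move=> s0 mX XN mk k0.
have lawE (f : R -> \bar R) : measurable_fun setT f -> (forall x, 0 <= f x)%E ->
    (\int[P]_w f (X w) = \int[lebesgue_measure]_x (f x * (normal_pdf 0 s x)%:E))%E.
  move=> mf f0.
  rewrite -(@ge0_integral_density _ _ _ _ (normal_prob 0 s))//; last 2 first.
  - exact: measurable_normal_pdf.
  - by move=> x; exact: normal_pdf_ge0.
  pose T := measurableTypeR R.
  have <- := @ge0_integral_pushforward _ _ Omega T R _ mX P setT f
    measurableT mf (fun x _ => f0 x).
  by apply: eq_measure_integral => A mA _; exact: XN.
have mG : measurable_fun setT (fun x : R => expR ((a * x - a ^+ 2 / 2) / s ^+ 2)).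
  apply: measurableT_comp => //; apply: measurable_funM => //.
  by apply: measurable_funB => //; exact: measurable_funM.
have mka : measurable_fun setT (fun x : R => k (x + a)).
  by apply: (measurableT_comp mk); exact: measurable_funD.
rewrite (lawE (fun x => k (x + a)))//.
rewrite (lawE (fun x => k x * (expR ((a * x - a ^+ 2 / 2) / s ^+ 2))%:E)%E);
  last 2 first.
- by apply: emeasurable_funM => //; exact/measurable_EFinP.
- by move=> x; rewrite mule_ge0// lee_fin expR_ge0.
pose F x := (k x * (normal_pdf 0 s (x - a))%:E)%E.
transitivity (\int[lebesgue_measure]_x F x)%E.
  have mF : measurable_fun setT F.
    apply: emeasurable_funM => //; apply/measurable_EFinP.
    apply: (measurableT_comp (measurable_normal_pdf 0 s)).
    exact: measurable_funB.
  have F0 x : (0 <= F x)%E by rewrite mule_ge0// lee_fin normal_pdf_ge0.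
  rewrite -(ge0_integral_shift a mF F0).
  by apply: eq_integral => x _; rewrite /F addrK.
by apply: eq_integral => x _; rewrite /F normal_pdf_shift// -muleA EFinM.
Qed.

Section IsotropicGaussian.
Variables (R : realType) (d : measure_display) (Omega : measurableType d).
Variables (P : probability Omega R) (n : nat) (v : R) (X : Omega -> 'rV[R]_n).
Hypothesis GX : isotropic_gaussian P v X.
Hypothesis v0 : 0 < v.

Let s := Num.sqrt v.

Let s0 : s != 0. Proof. by rewrite gt_eqF// sqrtr_gt0. Qed.

Let mXj j : measurable_fun setT (fun w => X w 0 j).
Proof. by case: GX. Qed.

Lemma measurable_isotropic_gaussian :
  measurable_fun setT (X : Omega -> borel_mxType R 1 n).
Proof. by apply/measurable_mxP => i j; rewrite ord1. Qed.

(** Replacing a coordinate by 0, rather than removing it, keeps the type of the vector while leaving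
    a function of the other coordinates only. *)
Let zero_coord (j : 'I_n) (x : 'rV[R]_n) : 'rV[R]_n :=
  \row_k (if k == j then 0 else x 0 k).

Let measurable_zero_coord j : measurable_fun setT
  ((fun w => zero_coord j (X w)) : Omega -> borel_mxType R 1 n).
Proof.
apply/measurable_mxP => i k; under eq_fun do rewrite mxE.
by have [_|_] := eqVneq k j; [exact: measurable_cst|exact: mXj].
Qed.

Let indep_coord (j : 'I_n) (B : set (borel_mxType R 1 n)) (A : set R) :
  measurable B -> measurable A ->
  (P ((fun w => zero_coord j (X w)) @^-1` B `&` (fun w => X w 0%R j) @^-1` A)
   = P ((fun w => zero_coord j (X w)) @^-1` B) * P ((fun w => X w 0%R j) @^-1` A))%E.
Proof.
move=> mB mA; rewrite setIC muleC; move: B mB.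
have mU : measurable ((fun w => X w 0 j) @^-1` A).
  by rewrite -[X in measurable X]setTI; exact: mXj.
apply: (@indep_generated _ _ _ _ P (borel_mxType R 1 n) _ _ (@mx_boxes R 1 n)) => //.
- exact: borel_mxE.
- exact: setI_closed_mx_boxes.
- exact: mx_boxes_setT.
move=> _ [C mC ->].
(* The erased coordinate is constantly 0, so side [j] of the box is either an impossible constraint
   or no constraint; in the second case its slot is free to receive [A]. *)
have [Cj0|Cj0] := pselect (C 0 j 0); last first.
  have -> : (fun w => zero_coord j (X w)) @^-1` mx_box C = set0.
    by apply/seteqP; split => // w /(_ 0 j); rewrite mxE eqxx.
  by rewrite setI0 measure0 mule0.
pose D k := if k == j then A else C 0 k.
have mD k : measurable (D k) by rewrite /D; case: ifP.
have boxE : (fun w => zero_coord j (X w)) @^-1` mx_box C =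
    \bigcap_(k in [set` [set k | k != j]%SET]) ((fun w => X w 0 k) @^-1` D k).
  apply/seteqP; split => w /= wC.
    move=> k /=; rewrite !inE /D => /negbTE kj.
    by have := wC 0 k; rewrite mxE kj.
  move=> i k; rewrite ord1 mxE; have [->//|kj] := eqVneq k j.
  by have := wC k; rewrite /= !inE /D (negbTE kj); exact.
have UE : (fun w => X w 0 j) @^-1` A `&` (fun w => zero_coord j (X w)) @^-1` mx_box C =
    \bigcap_(k in [set` [set: 'I_n]%SET]) ((fun w => X w 0 k) @^-1` D k).
  rewrite boxE; apply/seteqP; split => w /=.
    move=> [Aw Dw] k _; have [->|kj] := eqVneq k j; first by rewrite /D eqxx.
    by apply: Dw; rewrite /= !inE.
  move=> Dw; split; last by move=> k _; apply: Dw; rewrite /= inE.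
  by have := Dw j; rewrite /= /D eqxx inE; exact.
have [_ _ indX] := GX.
rewrite UE boxE !indX// (bigD1 j)//=; last by rewrite inE.
congr (_ * _)%E; first by rewrite /D eqxx.
by apply: eq_bigl => k; rewrite !inE.
Qed.

(** The other coordinates are independent of the [j]-th: with them frozen, this is the
    one-dimensional formula, and the two integrals are then merged again. *)
Let shift_coord (j : 'I_n) (a : R) (f : borel_mxType R 1 n -> \bar R) :
  measurable_fun setT f -> (forall x, 0 <= f x)%E ->
  (\int[P]_w f (X w + a *: delta_mx 0 j)%R
   = \int[P]_w (f (X w) * (expR ((a * X w 0%R j - a ^+ 2 / 2) / s ^+ 2))%:E))%E.
Proof.
move=> mf f0; pose Y w := zero_coord j (X w).
have XE w b : X w + b *: delta_mx 0 j = Y w + (X w 0 j + b) *: delta_mx 0 j.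
  apply/rowP => k; rewrite !mxE eqxx /=.
  by have [->|] := eqVneq k j; rewrite ?mulr1 ?add0r ?mulr0.
pose Z (u : borel_mxType R 1 n * R) : borel_mxType R 1 n :=
  (u.1 : 'rV[R]_n) + u.2 *: delta_mx 0 j.
have mZ : measurable_fun setT Z.
  apply/measurable_mxP => i k; rewrite ord1.
  have -> : (fun u => Z u 0 k) =
      (fun u => (u.1 : 'rV[R]_n) 0 k + u.2 * (delta_mx 0 j : 'rV[R]_n) 0 k).
    by apply/funext => u; rewrite /Z !mxE.
  apply: measurable_funD; first exact: (measurableT_comp (measurable_mx_entry 0 k)).
  exact: measurable_funM.
have mZa : measurable_fun setT (fun u : borel_mxType R 1 n * R => Z (u.1, u.2 + a)).
  apply: (measurableT_comp mZ); apply: measurable_fun_pair => //.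
  exact: measurable_funD.
pose G (x : R) := expR ((a * x - a ^+ 2 / 2) / s ^+ 2).
have mG : measurable_fun setT G.
  apply: measurableT_comp => //; apply: measurable_funM => //.
  by apply: measurable_funB => //; exact: measurable_funM.
have [_ XN _] := GX.
under eq_integral do rewrite XE.
have := @ge0_integral_indep _ _ _ _ Omega P (borel_mxType R 1 n) _ Y
  (fun w => X w 0 j) (fun u => f (Z (u.1, u.2 + a))).
move=> -> //; last 3 first.
- exact: measurable_zero_coord.
- by move=> B A mB mA; exact: indep_coord.
- exact: (measurableT_comp mf).
transitivity (\int[P]_w \int[P]_w' (f (Z (Y w, X w' 0%R j)) * (G (X w' 0%R j))%:E))%E.
  apply: eq_integral => w _ /=.
  apply: (@ge0_integral_normal_shift _ _ _ P (fun w' => X w' 0 j) s a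
    (fun x => f (Z (Y w, x)))) => //.
    exact: XN.
  apply: (measurableT_comp mf); apply: (measurableT_comp mZ).
  exact: measurable_fun_pair.
have := @ge0_integral_indep _ _ _ _ Omega P (borel_mxType R 1 n) _ Y
  (fun w => X w 0 j) (fun u => (f (Z u) * (G u.2)%:E)%E).
move=> /= <- //; last 4 first.
- exact: measurable_zero_coord.
- by move=> B A mB mA; exact: indep_coord.
- apply: emeasurable_funM; first exact: (measurableT_comp mf).
  by apply/measurable_EFinP; exact: (measurableT_comp mG).
- by move=> u; rewrite mule_ge0// lee_fin expR_ge0.
apply: eq_integral => w _; congr (f _ * _)%E.
by rewrite /Z /= -[RHS]addr0 -(scale0r (delta_mx 0 j)) XE addr0.
Qed.

(** The coordinates are shifted one at a time, each contributing its factor to the density. The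
    induction is on [k], for the vector [sh k] that keeps the first [k] coordinates of [a]. *)
Lemma ge0_integral_gaussian_shift (a : 'rV[R]_n) (f : borel_mxType R 1 n -> \bar R) :
  measurable_fun setT f -> (forall x, 0 <= f x)%E ->
  (\int[P]_w f (X w + a)%R
   = \int[P]_w (f (X w)
       * (expR ((\sum_j (a 0%R j * X w 0%R j - a 0%R j ^+ 2 / 2)) / v))%:E))%E.
Proof.
have s2 : s ^+ 2 = v by rewrite sqr_sqrtr// ltW.
pose sh k : 'rV[R]_n := \row_(j < n) (if (j < k)%N then a 0 j else 0).
suff H k : (k <= n)%N -> forall f : borel_mxType R 1 n -> \bar R,
    measurable_fun setT f -> (forall x, 0 <= f x)%E ->
    (\int[P]_w f (X w + sh k)%R
     = \int[P]_w (f (X w)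
       * (expR ((\sum_(j < n | (j < k)%N)
            (a 0%R j * X w 0%R j - a 0%R j ^+ 2 / 2)) / v))%:E))%E.
  move=> mf f0; have := H n (leqnn n) f mf f0.
  have -> : sh n = a by apply/rowP => j; rewrite mxE ltn_ord.
  move=> ->; apply: eq_integral => w _.
  by under eq_bigl do rewrite ltn_ord.
elim: k => [_ {}f mf f0|k IH kn {}f mf f0].
  apply: eq_integral => w _; rewrite big_pred0// mul0r expR0 mule1.
  by congr f; apply/rowP => j; rewrite !mxE addr0.
pose j0 := Ordinal kn.
have shS : sh k.+1 = a 0 j0 *: delta_mx 0 j0 + sh k.
  apply/rowP => j; rewrite !mxE ltnS leq_eqVlt eqxx /= -val_eqE /=.
  have [jk|] := eqVneq (j : nat) k; last by rewrite mulr0 add0r.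
  by rewrite jk ltnn /= mulr1 addr0; congr (a 0 _); apply: val_inj.
have mshift (b : 'rV[R]_n) :
    measurable_fun setT ((fun x : 'rV[R]_n => x + b)
      : borel_mxType R 1 n -> borel_mxType R 1 n).
  apply/measurable_mxP => i j.
  have -> : (fun x => (x + b) i j) = (fun x : 'rV[R]_n => x i j + b i j).
    by apply/funext => x; rewrite mxE.
  by apply: measurable_funD => //; exact: measurable_mx_entry.
under eq_integral do rewrite shS addrA.
rewrite (shift_coord j0 (a 0 j0) (measurableT_comp mf (mshift (sh k)))
  (fun x => f0 (x + sh k))).
pose g (x : borel_mxType R 1 n) :=
  (f x * (expR ((a 0%R j0 * x 0%R j0 - a 0%R j0 ^+ 2 / 2) / s ^+ 2))%:E)%E.
have mg : measurable_fun setT g.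
  apply: emeasurable_funM => //; apply/measurable_EFinP.
  apply: measurableT_comp => //; apply: measurable_funM => //.
  apply: measurable_funB => //; apply: measurable_funM => //.
  exact: measurable_mx_entry.
(* [sh k] vanishes at [j0], so shifting by it does not change the factor of that coordinate, which
   can be absorbed into the test function. *)
transitivity (\int[P]_w g (X w + sh k)%R)%E.
  by apply: eq_integral => w _; rewrite /g !mxE /= ltnn addr0.
rewrite (IH (ltnW kn) g mg); last by move=> x; rewrite mule_ge0// lee_fin expR_ge0.
have sumS (F : 'I_n -> R) : \sum_(j < n | (j < k.+1)%N) F j =
    F j0 + \sum_(j < n | (j < k)%N) F j.
  rewrite (bigD1 j0)//=; congr (_ + _); apply: eq_bigl => j.
  by rewrite ltnS -val_eqE /= andbC ltn_neqAle.
apply: eq_integral => w _; rewrite sumS mulrDl expRD EFinM muleA.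
by rewrite /g s2.
Qed.

End IsotropicGaussian.

(** * The Gaussian mechanism *)

(* Markov's inequality for [exp (p l)] with [l] the privacy loss: since [h <= 1],
   [h e^l <= e^eps h + (e^l - e^eps)^+ <= e^eps h + kap e^(eps + p (l - eps))]. *)
Lemma ge0_integral_gaussian_shift_le (R : realType) (d : measure_display)
    (Omega : measurableType d) (P : probability Omega R) (n : nat) (v : R)
    (X : Omega -> 'rV[R]_n) (a : 'rV[R]_n) (eps p kap : R)
    (h : borel_mxType R 1 n -> \bar R) :
  isotropic_gaussian P v X -> 0 < v -> measurable_fun setT h ->
  (forall x, 0 <= h x <= 1)%E ->
  0 <= kap -> (forall t, expR t - 1 <= kap * expR (p * t)) ->
  (\int[P]_w h (X w + a)%R <=
   (expR eps)%:E * \int[P]_w h (X w)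
   + (kap * expR ((p - 1) * (p * (\sum_j a 0%R j ^+ 2 / v) / 2 - eps)))%:E)%E.
Proof.
move=> GX v0 mh h01 kap0 kapE.
have h0 x : (0 <= h x)%E by case/andP: (h01 x).
have mX := measurable_isotropic_gaussian GX.
pose l (b : 'rV[R]_n) w := (\sum_j (b 0 j * X w 0 j - b 0 j ^+ 2 / 2)) / v.
have ml b : measurable_fun setT (l b).
  apply: measurable_funM => //; apply: measurable_sum => j.
  apply: measurable_funB => //; apply: measurable_funM => //.
  by case: GX.
have mhX : measurable_fun setT (fun w => h (X w)) by exact: (measurableT_comp mh).
rewrite (ge0_integral_gaussian_shift GX)// -/(l a).
pose K := kap * expR ((p - 1) * (p * (\sum_j a 0%R j ^+ 2 / v) / 2 - eps)).
have K0 : 0 <= K by rewrite mulr_ge0// expR_ge0.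
(* Up to a constant, [exp (p l)] is the density attached to the shift [p *: a]; the constant is
   gathered in [K]. *)
have lE w : kap * expR (eps + p * (l a w - eps)) = K * expR (l (p *: a) w).
  rewrite /K -mulrA -expRD; congr (_ * expR _).
  have -> : l (p *: a) w =
      p * l a w - (p ^+ 2 - p) / 2 * (\sum_j a 0%R j ^+ 2 / v).
    rewrite /l !mulr_suml !mulr_sumr -sumrB; apply: eq_bigr => j _.
    by rewrite mxE; field; rewrite gt_eqF.
  by field.
(* A density has total mass 1: this is the shift formula for the constant test function 1. *)
have mgf : (\int[P]_w (expR (l (p *: a) w))%:E = 1)%E.
  have := ge0_integral_gaussian_shift GX v0 (p *: a) (measurable_cst 1%E).
  move=> /(_ (fun=> lee01)) H.
  have <- : (\int[P]_w cst 1 w = 1)%E by rewrite integral_cst//= mul1e probability_setT.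
  by rewrite H; apply: eq_integral => w _; rewrite mul1e.
apply: (@le_trans _ _ (\int[P]_w ((expR eps)%:E * h (X w)
    + K%:E * (expR (l (p *: a) w))%:E))%E); last first.
  rewrite ge0_integralD//; last 4 first.
  - by move=> w _; rewrite mule_ge0// lee_fin expR_ge0.
  - exact: emeasurable_funM.
  - by move=> w _; rewrite -EFinM lee_fin mulr_ge0// expR_ge0.
  - by apply: emeasurable_funM => //; apply/measurable_EFinP; exact: measurableT_comp.
  rewrite ge0_integralZl// ge0_integralZl//; last first.
    by apply/measurable_EFinP; exact: measurableT_comp.
  by rewrite mgf mule1.
apply: ge0_le_integral => //.
- by move=> w _; rewrite mule_ge0// lee_fin expR_ge0.
- apply: emeasurable_funM => //; apply/measurable_EFinP.
  exact: (measurableT_comp _ (ml a)).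
- apply: emeasurable_funD; first exact: emeasurable_funM.
  by apply: emeasurable_funM => //; apply/measurable_EFinP; exact: measurableT_comp.
move=> w _; rewrite -/(l a w) -EFinM.
have := h01 (X w); rewrite -lE; case: (h (X w)) => [y| |].
- rewrite -EFinM -EFinM -EFinD !lee_fin => /andP[y0 y1].
  have -> : l a w = eps + (l a w - eps) by rewrite addrC subrK.
  rewrite [eps + _ - eps]addrAC subrr add0r; move: (l a w - eps) => t.
  have := kapE t; have := mulr_ge0 kap0 (expR_ge0 (p * t)); have := expR_gt0 eps.
  rewrite !expRD; set u := expR t; set e := expR eps; set k := expR (p * t).
  move=> e0 k0 kt.
  (* After division by [e] there remains [y * u <= y + kap * k], which follows from
     [u - 1 <= kap * k] multiplied by [y] in [0, 1]. *)
  rewrite mulrCA (mulrCA kap) -(mulrC y) (mulrC y e) -mulrDr ler_pM2l//.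
  by nra.
- by rewrite leye_eq andbF.
- by rewrite leeNy_eq.
Qed.

(** With [u = exp t] this follows from Bernoulli's inequality [u^p >= 1 + p (u - 1)], itself
    obtained here from [exp y >= 1 + y] at [(p - 1) t] and at [- t]. *)
Lemma expR_sub1_le (R : realType) (p t : R) : 1 <= p ->
  expR t - 1 <= p^-1 * expR (p * t).
Proof.
move=> p1; have p0 : 0 < p by lra.
rewrite -(ler_pM2l p0) mulVKf ?gt_eqF//.
have -> : p * t = t + (p - 1) * t by ring.
rewrite expRD.
have A := expR_ge1Dx ((p - 1) * t); have B := expR_ge1Dx (- t).
have C : expR t * expR (- t) = 1 by rewrite -expRD subrr expR0.
have := expR_gt0 t.
move: A B C; set u := expR t; set x := expR (- t); set y := expR _ => A B C u0.
have := ler_wpM2l (ltW u0) A; have : (p - 1) * (u * (1 - t)) <= (p - 1) * 1.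
  by apply: ler_wpM2l; [lra|have := ler_wpM2l (ltW u0) B; lra].
by nra.
Qed.

(** For [p = 2] the square of [u / 2 - 1] gives the constant 1/4, which improves on the 1/2 of
    [expR_sub1_le]. *)
Lemma expR_sub1_le_sqr (R : realType) (t : R) :
  expR t - 1 <= 4^-1 * expR (2 * t).
Proof.
have -> : 2 * t = t + t by ring.
by rewrite expRD; set u := expR t; have := sqr_ge0 (u / 2 - 1); nra.
Qed.

(** Provides rational lower bounds of exponentials, to be compared with the numerical constants of
    the next proof. *)
Lemma expRN_ge (R : realType) (c : R) (k : nat) : c <= k.+1%:R ->
  (1 - c / k.+1%:R) ^+ k.+1 <= expR (- c).
Proof.
move=> ck.
have -> : - c = (- c / k.+1%:R) * k.+1%:R by rewrite mulfVK// pnatr_eq0.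
rewrite expRM_natr lerXn2r ?nnegrE ?expR_ge0//.
  by rewrite subr_ge0 ler_pdivrMr// mul1r.
by rewrite (le_trans _ (expR_ge1Dx _))// mulNr.
Qed.

(** With [x = 2 ln (5 / 4 / delta)], the target is [5/4 exp (- x / 2)] and [q <= eps^2 / x]. It
    therefore suffices that the exponent be at most a constant minus [x / 2], with [kap] times the
    exponential of that constant at most 5/4. *)
Lemma gaussian_privacy_constant (R : realType) (eps delta q : R) :
  0 < eps -> eps <= 1 -> 0 < delta -> delta < 1 -> 0 <= q ->
  q * (2 * ln (5 / 4 / delta)) <= eps ^+ 2 ->
  exists p kap, [/\ 0 <= kap, (forall t, expR t - 1 <= kap * expR (p * t))
    & kap * expR ((p - 1) * (p * q / 2 - eps)) <= delta].
Proof.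
move=> eps0 eps1 delta0 delta1 q0; set x := 2 * _ => qx.
have d54 : 1 < 5 / 4 / delta by rewrite ltr_pdivlMr// mul1r; lra.
have deltaE : delta = 5 / 4 * expR (- (x / 2)).
  have -> : x / 2 = ln (5 / 4 / delta) by rewrite /x mulrC mulKf.
  rewrite expRN lnK ?posrE; last by lra.
  by field; rewrite gt_eqF.
(* [delta < 1] gives [x > 2 ln (5/4)], of which 43/100 is a rational lower bound. *)
have x43 : 43 / 100 <= x.
  have H : (1 - (43/200) / 8) ^+ 8 <= expR (- (43/200)) :> R by apply: expRN_ge; lra.
  have : expR (- (x / 2)) <= expR (- (43/200)).
    apply: le_trans H.
    have : expR (- (x / 2)) < 4 / 5 by move: delta1; rewrite deltaE; lra.
    move=> /ltW/le_trans; apply; lra.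
  by rewrite ler_expR; lra.
have x0 : 0 < x by lra.
have qle : q <= eps ^+ 2 / x by rewrite ler_pdivlMr.
have [ex|xe] := leP eps x.
(* This [p] minimises the exponent when [q = eps^2 / x]. Here [p >= 3/2], so [kap <= 2/3], and
   [2/3 exp (1/2) <= 5/4]. *)
- exists (x / eps + 1 / 2), (x / eps + 1 / 2)^-1.
  have xe1 : 1 <= x / eps by rewrite ler_pdivlMr// mul1r.
  set p := x / eps + 1 / 2.
  have p32 : 3 / 2 <= p by rewrite /p; lra.
  have p0 : 0 < p by lra.
  split; first by rewrite invr_ge0 ltW.
    by move=> t; apply: expR_sub1_le; lra.
  have E : (p - 1) * (p * q / 2 - eps) <= 1 / 2 - x / 2.
    apply: (@le_trans _ _ ((p - 1) * (p * (eps ^+ 2 / x) / 2 - eps))).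
      rewrite ler_wpM2l//; first lra.
      by rewrite lerB// ler_pM2r// ler_pM2l.
    have -> : (p - 1) * (p * (eps ^+ 2 / x) / 2 - eps) =
        - x / 2 + eps / 2 - eps ^+ 2 / x / 8.
      by rewrite /p; field; rewrite !gt_eqF.
    have : 0 <= eps ^+ 2 / x by rewrite divr_ge0 ?sqr_ge0// ltW.
    lra.
  have pV : p^-1 <= 2 / 3 by rewrite -[2 / 3]invf_div lef_pV2 ?posrE.
  apply: (@le_trans _ _ (2 / 3 * expR (1 / 2 - x / 2))).
    by rewrite ler_pM ?invr_ge0 ?expR_ge0 ?ler_expR// ltW.
  rewrite deltaE expRD mulrA ler_pM2r ?expR_gt0//.
  have H : (1 - (1/2) / 2) ^+ 2 <= expR (- (1/2)) :> R by apply: expRN_ge; lra.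
  have : expR (1 / 2) * expR (- (1 / 2)) = 1 :> R by rewrite -expRD subrr expR0.
  have := expR_gt0 (1 / 2 : R).
  by move: H; set u := expR (1 / 2); set w := expR _; nra.
(* Now [43/100 <= x < eps <= 1]. The bound on [q - eps] is largest at [eps = 1], where it is
   [1 / x - 1], at most [155/100 - x / 2] on this range; finally [exp (155/100) <= 5]. *)
exists 2, 4^-1; split; first by rewrite invr_ge0.
  exact: expR_sub1_le_sqr.
have -> : (2 - 1) * (2 * q / 2 - eps) = q - eps by field.
have E : q - eps <= 155 / 100 - x / 2.
  have : q <= 1 / x - 1 + eps.
    apply: (le_trans qle); rewrite -subr_ge0.
    have -> : 1 / x - 1 + eps - eps ^+ 2 / x = (1 - eps) * (1 + eps - x) / x.
      by field; rewrite gt_eqF.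
    by rewrite divr_ge0 ?(ltW x0)// mulr_ge0//; lra.
  have : 1 / x <= 255 / 100 - x / 2 by rewrite ler_pdivrMr//; nra.
  lra.
apply: (@le_trans _ _ (4^-1 * expR (155 / 100 - x / 2))).
  by rewrite ler_pM2l ?invr_gt0// ler_expR.
rewrite deltaE expRD mulrA ler_pM2r ?expR_gt0//.
have H : (1 - (155/100) / 32) ^+ 32 <= expR (- (155/100)) :> R by apply: expRN_ge; lra.
have H2 : 1 / 5 <= expR (- (155/100)) :> R by apply: le_trans H; lra.
have : expR (155/100) * expR (- (155/100)) = 1 :> R by rewrite -expRD subrr expR0.
have := expR_gt0 (155 / 100 : R).
by move: H2; set u := expR (155 / 100); set w := expR _; nra.
Qed.

(** * The Frobenius norm and the sensitivity of an iteration *)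

Section Frobenius.
Variables (R : realType) (m n : nat).
Implicit Types (A B X Y : 'M[R]_(m, n)) (r c : R).

Lemma mxinnerE A B : mxinner A B = \sum_i \sum_j A i j * B i j.
Proof.
rewrite exchange_big; apply: eq_bigr => j _; rewrite mxE.
by apply: eq_bigr => i _; rewrite mxE.
Qed.

Lemma mxinnerC A B : mxinner A B = mxinner B A.
Proof. by rewrite /mxinner -mxtrace_tr trmx_mul trmxK. Qed.

Lemma mxinnerDl A B X : mxinner (A + B) X = mxinner A X + mxinner B X.
Proof. by rewrite /mxinner linearD mulmxDl mxtraceD. Qed.

Lemma mxinnerZl c A X : mxinner (c *: A) X = c * mxinner A X.
Proof. by rewrite /mxinner linearZ -scalemxAl mxtraceZ. Qed.

Lemma mxinner_ge0 A : 0 <= mxinner A A.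
Proof.
by rewrite mxinnerE; do 2 (apply: sumr_ge0 => ? _); rewrite -expr2 sqr_ge0.
Qed.

Lemma mxinner_eq0 A : mxinner A A <= 0 -> A = 0.
Proof.
move=> A0; have /eqP : mxinner A A = 0 by apply/eqP; rewrite eq_le A0 mxinner_ge0.
rewrite mxinnerE psumr_eq0 => [/allP H|i _]; last first.
  by apply: sumr_ge0 => j _; rewrite -expr2 sqr_ge0.
apply/matrixP => i j; have := H i (mem_index_enum _).
rewrite psumr_eq0 => [/allP /(_ j (mem_index_enum _))|k _]; last first.
  by rewrite -expr2 sqr_ge0.
by rewrite /= -expr2 sqrf_eq0 mxE => /eqP.
Qed.

Lemma frobenius_ge0 A : 0 <= frobenius A.
Proof. exact: sqrtr_ge0. Qed.

Lemma sqr_frobenius A : frobenius A ^+ 2 = mxinner A A.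
Proof. by rewrite sqr_sqrtr// mxinner_ge0. Qed.

Lemma frobenius_le A c : 0 <= c -> (frobenius A <= c) = (mxinner A A <= c ^+ 2).
Proof.
by move=> c0; rewrite -sqr_frobenius ler_pXn2r// nnegrE frobenius_ge0.
Qed.

Lemma frobeniusZ c A : frobenius (c *: A) = `|c| * frobenius A.
Proof.
rewrite /frobenius mxinnerZl mxinnerC mxinnerZl mulrA -expr2.
by rewrite sqrtrM ?sqr_ge0// sqrtr_sqr.
Qed.

Lemma frobenius0 : frobenius (0 : 'M[R]_(m, n)) = 0.
Proof. by rewrite -(scale0r (0 : 'M[R]_(m, n))) frobeniusZ normr0 mul0r. Qed.

Lemma frobeniusN A : frobenius (- A) = frobenius A.
Proof. by rewrite -scaleN1r frobeniusZ normrN1 mul1r. Qed.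

(** Cauchy-Schwarz: for nonzero norms [a] and [b], expand the squared norm of [b *: A - a *: B] and
    divide by [a * b]. *)
Lemma mxinner_le A B : mxinner A B <= frobenius A * frobenius B.
Proof.
have [B0|B0] := leP (frobenius B) 0.
  have B00 : B = 0.
    apply: mxinner_eq0; rewrite -sqr_frobenius.
    have -> : frobenius B = 0 by apply/eqP; rewrite eq_le B0 frobenius_ge0.
    by rewrite expr0n.
  by rewrite B00 frobenius0 mulr0 mxinnerC -(scale0r B) mxinnerZl mul0r.
have [A0|A0] := leP (frobenius A) 0.
  have A00 : A = 0.
    apply: mxinner_eq0; rewrite -sqr_frobenius.
    have -> : frobenius A = 0 by apply/eqP; rewrite eq_le A0 frobenius_ge0.
    by rewrite expr0n.
  by rewrite A00 frobenius0 mul0r -(scale0r A) mxinnerZl mul0r.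
set a := frobenius A; set b := frobenius B.
have := mxinner_ge0 (b *: A + (- a) *: B).
rewrite mxinnerDl !mxinnerZl (mxinnerC A) (mxinnerC B) !mxinnerDl !mxinnerZl.
rewrite -!sqr_frobenius -/a -/b (mxinnerC B A) => H.
have ab : 0 < a * b by rewrite mulr_gt0.
rewrite -(ler_pM2l ab); nra.
Qed.

Lemma ler_norm_mxinner A B : `|mxinner A B| <= frobenius A * frobenius B.
Proof.
rewrite ler_norml mxinner_le andbT lerNl.
have -> : - mxinner A B = mxinner (- A) B by rewrite -(scaleN1r A) mxinnerZl mulN1r.
by rewrite -(frobeniusN A) mxinner_le.
Qed.

Lemma frobeniusD A B : frobenius (A + B) <= frobenius A + frobenius B.
Proof.
rewrite frobenius_le ?addr_ge0 ?frobenius_ge0//.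
rewrite mxinnerDl (mxinnerC A) (mxinnerC B) !mxinnerDl (mxinnerC B A).
rewrite -!sqr_frobenius; have := mxinner_le A B; nra.
Qed.

(** The projection is a chosen minimiser, so the closed form requires both that [Q] is a minimiser,
    by the triangle inequality, and that there is no other. Measurability and the norm bound of the
    projection rest on this formula. *)
Lemma frobenius_projE r X : 0 < r ->
  frobenius_proj r X = (r / Num.max r (frobenius X)) *: X.
Proof.
move=> r0; set Q := _ *: X.
have Qr : frobenius Q <= r.
  rewrite frobeniusZ ger0_norm; last by rewrite divr_ge0 ?le_max ?(ltW r0).
  by rewrite mulrAC ler_pdivrMr ?lt_max ?r0// ler_pM2l// le_max lexx orbT.
have XQ : frobenius (X - Q) = Num.max 0 (frobenius X - r).
  have -> : X - Q = (1 - r / Num.max r (frobenius X)) *: X by rewrite scalerBl scale1r.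
  rewrite frobeniusZ; have [Xr|Xr] := leP (frobenius X) r.
    by rewrite divff ?gt_eqF// subrr normr0 mul0r; apply/esym/max_idPl; lra.
  have X0 : 0 < frobenius X by exact: lt_trans r0 Xr.
  rewrite ger0_norm; last by rewrite subr_ge0 ler_pdivrMr// mul1r ltW.
  rewrite mulrBl mul1r divfK ?gt_eqF//; apply/esym/max_idPr.
  by rewrite subr_ge0 ltW.
have Qmin Y : frobenius Y <= r -> frobenius (X - Q) <= frobenius (X - Y).
  move=> Yr; rewrite XQ ge_max frobenius_ge0/= lerBlDr.
  rewrite -[X in frobenius X <= _](subrK Y).
  by rewrite (le_trans (frobeniusD _ _))// lerD2l.
rewrite /frobenius_proj /argmin; set S := [set Y | _].
have SQ : S Q by split.
have [Yr] : S (get S) by apply: getPex; exists Q.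
set Y := get S in Yr *.
move=> /(_ Q Qr) => YQ; apply/subr0_eq; apply: mxinner_eq0.
have H0 : frobenius (X - Y) <= Num.max 0 (frobenius X - r) by rewrite -XQ.
have [Xr|Xr] := leP (frobenius X) r.
  have -> : Q = X by rewrite /Q (max_idPl Xr) divff ?scale1r ?gt_eqF.
  rewrite -sqr_frobenius -opprB frobeniusN.
  have -> : frobenius (X - Y) = 0.
    apply/eqP; rewrite eq_le frobenius_ge0 andbT.
    by rewrite (le_trans H0)// ge_max lexx subr_le0.
  by rewrite expr0n.
have X0 : 0 < frobenius X by exact: lt_trans r0 Xr.
have c1 : r / frobenius X < 1 by rewrite ltr_pdivrMr// mul1r.
have QE : Q = (r / frobenius X) *: X by rewrite /Q (max_idPr (ltW Xr)).
move: H0; rewrite (max_idPr _); last by rewrite subr_ge0 ltW.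
rewrite frobenius_le; last by rewrite subr_ge0 ltW.
have E (A B : 'M[R]_(m, n)) c : mxinner (A - c *: B) (A - c *: B) =
    mxinner A A - 2 * c * mxinner A B + c ^+ 2 * mxinner B B.
  rewrite -scaleNr mxinnerDl mxinnerZl (mxinnerC A) (mxinnerC B) !mxinnerDl !mxinnerZl.
  by rewrite (mxinnerC B A); ring.
rewrite -[Y in X - Y]scale1r E QE E.
have : mxinner Y Y <= r ^+ 2 by rewrite -frobenius_le// ltW.
rewrite -!sqr_frobenius (mxinnerC Y X).
have rX : r = (r / frobenius X) * frobenius X by rewrite divfK// gt_eqF.
have c0 : 0 < r / frobenius X by rewrite divr_gt0.
move: rX c0 c1; set c := r / _; set x := frobenius X; set y := frobenius Y.
set q := mxinner X Y => rX c0 c1 yr H.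
(* The squared bound [|X - Y| <= |X| - r] bounds [q] from below. Inserted in [|Y - c X|^2], it
   leaves at most [(1 - c) (y^2 - r^2)], which is nonpositive, so [Y] is [Q]. *)
have : 2 * c * q >= c * (2 * r * x + y ^+ 2 - r ^+ 2).
  have -> : 2 * c * q = c * (2 * q) by ring.
  by rewrite ler_pM2l//; nra.
have : (1 - c) * (y ^+ 2 - r ^+ 2) <= 0 by rewrite mulr_ge0_le0//; lra.
have -> : c ^+ 2 * x ^+ 2 = r ^+ 2 by rewrite -exprMn -rX.
have -> : c * (2 * r * x + y ^+ 2 - r ^+ 2) =
    2 * r * (c * x) + c * (y ^+ 2 - r ^+ 2) by ring.
rewrite -rX; nra.
Qed.

Lemma frobenius_proj_le r X : 0 < r -> frobenius (frobenius_proj r X) <= r.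
Proof.
move=> r0; rewrite frobenius_projE// frobeniusZ ger0_norm; last first.
  by rewrite divr_ge0 ?le_max ?(ltW r0).
by rewrite mulrAC ler_pdivrMr ?lt_max ?r0// ler_pM2l// le_max lexx orbT.
Qed.

Lemma sum_mxvec_sqr A : \sum_j mxvec A 0 j ^+ 2 = frobenius A ^+ 2.
Proof.
rewrite sqr_frobenius mxinnerE pair_bigA /=.
rewrite (reindex _ (curry_mxvec_bij m n)) /=.
by apply: eq_bigr => -[i j] _; rewrite mxvecE expr2.
Qed.

End Frobenius.

(** Once a minimiser exists, [get] returns a point of the interval; depending on the position of
    [x], the witness is [- C], [C] or [x]. *)
Lemma ler_norm_clip (R : realType) (C x : R) : 0 <= C -> `|clip C x| <= C.
Proof.
move=> C0; rewrite /clip /argmin; set S := [set y | _].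
have [] : S (get S); last by rewrite /= in_itv /= ler_norml.
apply: getPex.
have [xC|xC] := leP x (- C); [|have [Cx|Cx] := leP C x].
- exists (- C); split; first by rewrite /= in_itv /=; lra.
  move=> y; rewrite /= in_itv /= => /andP[y1 y2].
  by rewrite !ler0_norm; lra.
- exists C; split; first by rewrite /= in_itv /=; lra.
  move=> y; rewrite /= in_itv /= => /andP[y1 y2].
  by rewrite !ger0_norm; lra.
- exists x; split; first by rewrite /= in_itv /=; lra.
  by move=> y _; rewrite subrr normr0.
Qed.

(** * Sensitivity of the gradient step to a change of one prompt *)

Section Sensitivity.
Variables (R : realType) (D L N : nat) (C r G lambda eta0 : R).
Hypotheses (C0 : 0 < C) (r0 : 0 < r) (G0 : 0 < G) (eta0_gt0 : 0 < eta0).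

(** The part of [noisy_step] that precedes the noise: the mean of the Gaussian vector that is then
    projected. *)
Definition ridge_step (Ds : prompts R D L N) (Gamma : 'M[R]_D) : 'M[R]_D :=
  (1 - 2 * lambda * eta0) *: Gamma
    - (eta0 / N%:R) *: (\sum_(k < N)
        (mxinner Gamma (Ztilde C G (Ds k)) - clip C (query_y (Ds k)))
          *: Ztilde C G (Ds k)).

Lemma frobenius_gradient (E : prompt R D L) (Gamma : 'M[R]_D) :
  frobenius Gamma <= r ->
  frobenius ((mxinner Gamma (Ztilde C G E) - clip C (query_y E)) *: Ztilde C G E)
    <= G * (C + r * G).
Proof.
move=> Gr; rewrite frobeniusZ mulrC.
have ZG : frobenius (Ztilde C G E) <= G by exact: frobenius_proj_le.
rewrite ler_pM ?frobenius_ge0// (le_trans (ler_normB _ _))// addrC lerD//.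
  by rewrite ler_norm_clip// ltW.
by rewrite (le_trans (ler_norm_mxinner _ _))// ler_pM// frobenius_ge0.
Qed.

(** The regularization term depends on [Gamma] only and cancels, as do the summands of equal
    prompts. At most one summand is left, a difference of two gradients, whence the factor 2. *)
Lemma frobenius_ridge_step_sub (Ds Ds' : prompts R D L N) (Gamma : 'M[R]_D) :
  neighbors Ds Ds' -> frobenius Gamma <= r ->
  frobenius (ridge_step Ds Gamma - ridge_step Ds' Gamma)
    <= eta0 / N%:R * (2 * G * (C + r * G)).
Proof.
move=> DD' Gr.
pose g E := (mxinner Gamma (Ztilde C G E) - clip C (query_y E)) *: @Ztilde R D L C G E.
have -> : ridge_step Ds Gamma - ridge_step Ds' Gamma =
    (eta0 / N%:R) *: (\sum_(k < N) (g (Ds' k) - g (Ds k))).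
  by rewrite /ridge_step opprB [LHS]addrC subrKA -scalerBr -sumrB.
have eN : 0 <= eta0 / N%:R by rewrite divr_ge0// ltW.
rewrite frobeniusZ ger0_norm// ler_wpM2l//.
have b0 : 0 <= 2 * G * (C + r * G).
  by rewrite !mulr_ge0// ?addr_ge0 ?mulr_ge0// ltW.
have [[k0 Dk0]|Deq] := pselect (exists k, Ds k <> Ds' k); last first.
  rewrite big1 ?frobenius0// => k _; have [->|Dk] := pselect (Ds k = Ds' k).
    by rewrite subrr.
  by exfalso; apply: Deq; exists k.
rewrite (bigD1 k0)//= big1 ?addr0 => [|k kk0]; last first.
  have [->|Dk] := pselect (Ds k = Ds' k); first by rewrite subrr.
  by move: kk0; rewrite (DD' _ _ Dk Dk0) eqxx.
rewrite (le_trans (frobeniusD _ _))// frobeniusN -mulrA mulrDl !mul1r.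
by rewrite lerD// frobenius_gradient.
Qed.

End Sensitivity.

(** * Composition *)

Section RandomIteration.
Variables (R : realType) (d d' : measure_display) (Omega : measurableType d).
Variables (P : probability Omega R) (T : measurableType d') (n : nat).
Variables (z : nat -> Omega -> T).
Hypothesis mz : forall t : 'I_n, measurable_fun setT (z t).
Hypothesis indep_z : mutually_independent P measurable (fun t : 'I_n => z t).

Fixpoint random_iter (g : T -> T -> T) (x0 : T) (t : nat) (w : Omega) : T :=
  if t is t'.+1 then g (random_iter g x0 t' w) (z t' w) else x0.

Lemma measurable_random_iter (g : T -> T -> T) (x0 : T) (t : nat) :
  measurable_fun setT (fun u : T * T => g u.1 u.2) -> (t <= n)%N ->
  measurable_fun setT (random_iter g x0 t).
Proof.
move=> mg; elim: t => [_|t IH tn]; first exact: measurable_cst.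
apply: (measurableT_comp mg (measurable_fun_pair (IH (ltnW tn)) _)).
exact: (mz (Ordinal tn)).
Qed.

(** An event about all the noises from time [t] on. The induction below needs the whole future,
    because each step takes the next noise out of it. *)
Let later (t : nat) (B : 'I_n -> set T) : set Omega :=
  \bigcap_(i in [set` [set i : 'I_n | (t <= i)%N]%SET]) (z i @^-1` B i).

(** The iterate at [t.+1] is a function of the iterate at [t] and of [z t]. For a rectangle of such
    pairs, the condition on [z t] is moved into the later event, to which the induction hypothesis
    at [t] applies. *)
Let indep_later (g : T -> T -> T) (x0 : T) (t : nat) (A : set T)
    (B : 'I_n -> set T) :
  measurable_fun setT (fun u : T * T => g u.1 u.2) -> (t <= n)%N ->
  measurable A -> (forall i, measurable (B i)) ->
  (P (later t B `&` random_iter g x0 t @^-1` A)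
   = P (later t B) * P (random_iter g x0 t @^-1` A))%E.
Proof.
move=> mg; elim: t => [|t IH] in A B *.
  move=> _ mA mB; have [Ax0|Ax0] := pselect (A x0).
    have -> : random_iter g x0 0 @^-1` A = setT by apply/seteqP; split.
    by rewrite setIT probability_setT mule1.
  have -> : random_iter g x0 0 @^-1` A = set0 by apply/seteqP; split.
  by rewrite setI0 measure0 mule0.
move=> tn mA mB.
have mlater k C : (forall i, measurable (C i)) -> measurable (later k C).
  move=> mC; apply: fin_bigcap_measurable; first exact: finite_finset.
  by move=> i _; rewrite -[X in measurable X]setTI; exact: mz.
have mY : measurable_fun setT (fun w => (random_iter g x0 t w, z t w)).
  apply: measurable_fun_pair; first exact: measurable_random_iter (ltnW tn).
  exact: (mz (Ordinal tn)).
have -> : random_iter g x0 t.+1 @^-1` A =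
    (fun w => (random_iter g x0 t w, z t w)) @^-1`
      ((fun u : T * T => g u.1 u.2) @^-1` A) by [].
have : measurable ((fun u : T * T => g u.1 u.2) @^-1` A).
  by rewrite -[X in measurable X]setTI; exact: mg.
move: {A mA} (_ @^-1` A).
apply: (@indep_generated _ _ _ _ P (T * T)%type _ _
  [set A1 `*` A2 | A1 in measurable & A2 in measurable]) => //.
- exact: mlater.
- by rewrite measurable_prod_measurableType.
- move=> _ _ [A1 mA1 [A2 mA2 <-]] [B1 mB1 [B2 mB2 <-]].
  exists (A1 `&` B1); first exact: measurableI.
  by exists (A2 `&` B2); [exact: measurableI|rewrite setXI].
- by exists setT => //; exists setT => //; rewrite setXTT.
move=> _ [A1 mA1 [A2 mA2 <-]].
pose t0 := Ordinal tn.
pose upd (C : 'I_n -> set T) i := if i == t0 then A2 else C i.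
have laterE C : later t (upd C) = later t.+1 C `&` z t @^-1` A2.
  apply/seteqP; split=> w /=.
    move=> H; split; last by have := H t0; rewrite /= inE /upd eqxx; exact.
    move=> i /=; rewrite inE => ti; have := H i; rewrite /= inE ltnW// => /(_ isT).
    rewrite /upd; have [it|//] := eqVneq i t0.
    by move: ti; rewrite it ltnn.
  move=> [H1 H2] i /=; rewrite inE => ti; rewrite /upd.
  have [->//|it] := eqVneq i t0; apply: (H1 i); rewrite /= inE ltn_neqAle ti andbT.
  by apply: contra it => /eqP it; apply/eqP/val_inj.
have mupd C : (forall i, measurable (C i)) -> forall i, measurable (upd C i).
  by move=> mC i; rewrite /upd; case: ifP.
have PlaterE C : (forall i, measurable (C i)) ->
    (P (later t (upd C)) = P (later t.+1 C) * P (z t @^-1` A2))%E.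
  move=> mC; rewrite /later !indep_z//; last exact: mupd.
  rewrite (bigD1 t0)/=; last by rewrite inE.
  rewrite /upd eqxx muleC; congr (_ * _)%E; apply: eq_big => i.
    by rewrite !inE ltn_neqAle -val_eqE /= eq_sym andbC.
  by move=> /andP[_ /negbTE ->].
have YE : (fun w => (random_iter g x0 t w, z t w)) @^-1` (A1 `*` A2) =
    z t @^-1` A2 `&` random_iter g x0 t @^-1` A1.
  by rewrite setIC; apply/seteqP; split.
rewrite YE setIA -laterE (IH _ _ (ltnW tn))//; last exact: mupd.
(* With trivial constraints after time [t], the induction hypothesis says that the iterate at [t] is
   independent of [z t]; this puts the last two factors back together. *)
have TE : later t.+1 (fun=> setT) = setT by apply/seteqP; split.
have := IH A1 (upd (fun=> setT)) (ltnW tn) mA1 (mupd _ (fun=> measurableT)).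
rewrite PlaterE// laterE TE setTI probability_setT mul1e => ->.
by rewrite PlaterE// muleA.
Qed.

Lemma integral_random_iterS (g : T -> T -> T) (x0 : T) (t : nat)
    (h : T -> \bar R) :
  measurable_fun setT (fun u : T * T => g u.1 u.2) -> (t < n)%N ->
  measurable_fun setT h -> (forall x, 0 <= h x)%E ->
  (\int[P]_w h (random_iter g x0 t.+1 w)
   = \int[P]_w \int[P]_w' h (g (random_iter g x0 t w) (z t w')))%E.
Proof.
move=> mg tn mh h0; have mzt := mz (Ordinal tn).
have miter := measurable_random_iter x0 mg (ltnW tn).
apply: (@ge0_integral_indep _ _ _ _ Omega P T T (random_iter g x0 t) (z t)
  (fun u => h (g u.1 u.2))) => //; last exact: (measurableT_comp mh mg).
move=> A B mA mB; rewrite setIC muleC.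
have zE : z t @^-1` B = later t (fun i => if i == Ordinal tn then B else setT).
  apply/seteqP; split=> w /=; first by move=> Bw i _ /=; case: eqP => // ->.
  by move=> /(_ (Ordinal tn)); rewrite /= inE eqxx; exact.
rewrite zE indep_later//; first exact: ltnW.
by move=> i; case: ifP.
Qed.

(* Truncating the test function at 1 keeps it admissible for the induction
   hypothesis, so that the [delta]s add up without a factor. *)
Lemma random_iter_dp (g g' : T -> T -> T) (x0 : T) (S : set T) (e dl : R) (t : nat)
    (h : T -> \bar R) :
  measurable_fun setT (fun u : T * T => g u.1 u.2) ->
  measurable_fun setT (fun u : T * T => g' u.1 u.2) ->
  S x0 -> (forall x y, S (g x y)) -> 0 <= dl ->
  (forall (t : 'I_n) (x : T) (h : T -> \bar R), S x -> measurable_fun setT h ->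
    (forall x, 0 <= h x <= 1)%E ->
    (\int[P]_w h (g x (z t w)) <=
     (expR e)%:E * \int[P]_w h (g' x (z t w)) + dl%:E)%E) ->
  (t <= n)%N -> measurable_fun setT h -> (forall x, 0 <= h x <= 1)%E ->
  (\int[P]_w h (random_iter g x0 t w) <=
   (expR (t%:R * e))%:E * \int[P]_w h (random_iter g' x0 t w)
     + (t%:R * dl)%:E)%E.
Proof.
move=> mg mg' Sx0 Sg dl0 step.
elim: t h => [|t IH] h tn mh h01.
  by rewrite !mul0r expR0 mul1e adde0.
have h0 x : (0 <= h x)%E by case/andP: (h01 x).
have mzt := mz (Ordinal tn).
(* The one-step bound holds for states in [S] only, a set that the iteration never leaves. *)
have Siter k w : S (random_iter g x0 k w) by case: k => [|k]; [exact: Sx0|exact: Sg].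
rewrite !integral_random_iterS//.
(* The expectation of the test function after one more step from the state [x]; its truncation [k]
   is the test function for the first [t] steps. *)
pose K (f : T -> T -> T) x := (\int[P]_w h (f x (z t w)))%E.
have mK f : measurable_fun setT (fun u : T * T => f u.1 u.2) ->
    measurable_fun setT (K f).
  move=> mf; apply: (@measurable_fun_fubini_tonelli_F _ _ T Omega R P
    (fun u => h (f u.1 (z t u.2)))) => //.
  have mp : measurable_fun setT (fun u : T * Omega => (u.1, z t u.2)).
    by apply: measurable_fun_pair => //; exact: measurableT_comp.
  exact: (measurableT_comp mh (measurableT_comp mf mp)).
have K0 f x : (0 <= K f x)%E by exact: integral_ge0.
have K1 x : (K g x <= 1)%E.
  have mgx : measurable_fun setT (fun w => h (g x (z t w))).
    have mp : measurable_fun setT (fun w => (x, z t w)).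
      exact: measurable_fun_pair.
    exact: (measurableT_comp mh (measurableT_comp mg mp)).
  apply: (@le_trans _ _ (\int[P]_w cst 1 w)%E).
    by apply: ge0_le_integral => // w _; case/andP: (h01 (g x (z t w))).
  by rewrite integral_cst//= mul1e probability_setT.
pose k x := Order.min 1%E ((expR e)%:E * K g' x)%E.
have mk : measurable_fun setT k.
  apply: measurable_mine; first exact: measurable_cst.
  by apply: emeasurable_funM => //; exact: mK.
have e0 : (0 <= (expR e)%:E)%E by rewrite lee_fin expR_ge0.
have k01 x : (0 <= k x <= 1)%E.
  by rewrite le_min lee01 mule_ge0//= ge_min lexx.
have k0 x : (0 <= k x)%E by case/andP: (k01 x).
have miter f : measurable_fun setT (fun u : T * T => f u.1 u.2) ->
    measurable_fun setT (random_iter f x0 t).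
  by move=> mf; exact: measurable_random_iter (ltnW tn).
(* If the minimum is 1, the bound is [K g <= 1]; otherwise it is the one-step privacy bound. *)
have Kk w : (K g (random_iter g x0 t w) <= k (random_iter g x0 t w) + dl%:E)%E.
  rewrite /k; set x := random_iter _ _ _ _.
  have [_|_] := leP 1%E ((expR e)%:E * K g' x)%E; last first.
    exact: (step (Ordinal tn) x h (Siter _ _) mh h01).
  by rewrite (le_trans (K1 _))// leeDl// lee_fin.
change (\int[P]_w K g (random_iter g x0 t w) <= (expR (t.+1%:R * e))%:E
  * \int[P]_w K g' (random_iter g' x0 t w) + (t.+1%:R * dl)%:E)%E.
apply: (@le_trans _ _ (\int[P]_w (k (random_iter g x0 t w) + cst dl%:E w))%E).
  apply: ge0_le_integral => //.
  - exact: (measurableT_comp (mK _ mg) (miter _ mg)).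
  - by apply: emeasurable_funD => //; exact: (measurableT_comp mk (miter _ mg)).
rewrite ge0_integralD//; last exact: (measurableT_comp mk (miter _ mg)).
have -> : (\int[P]_w cst dl%:E w = dl%:E)%E.
  by rewrite integral_cst//= probability_setT mule1.
apply: (le_trans (leeD2r _ (IH k (ltnW tn) mk k01))).
rewrite -addeA -EFinD.
have -> : t%:R * dl + dl = t.+1%:R * dl by rewrite -natr1 mulrDl mul1r.
have -> : expR (t.+1%:R * e) = expR (t%:R * e) * expR e.
  by rewrite -natr1 mulrDl mul1r expRD.
rewrite leeD2r// EFinM -muleA lee_wpmul2l ?lee_fin ?expR_ge0//.
rewrite -ge0_integralZl//; last first.
  exact: (measurableT_comp (mK _ mg') (miter _ mg')).
apply: ge0_le_integral => //.
- exact: (measurableT_comp mk (miter _ mg')).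
- apply: emeasurable_funM => //.
  exact: (measurableT_comp (mK _ mg') (miter _ mg')).
- by move=> w _; rewrite ge_min lexx orbT.
Qed.

End RandomIteration.

(** * NoisyHead *)

Section MeasurableStep.
Variables (R : realType) (d : measure_display) (T : measurableType d).

(** On nonnegative reals the inverse is the power of exponent -1, also at 0, where both are 0. *)
Lemma measurable_funVr (f : T -> R) : (forall x, 0 <= f x) ->
  measurable_fun setT f -> measurable_fun setT (fun x => (f x)^-1).
Proof.
move=> f0 mf.
have -> : (fun x => (f x)^-1) = (fun x => f x `^ (-1)).
  by apply/funext => x; rewrite powR_inv1.
exact: (measurableT_comp (measurable_powR (-1)) mf).
Qed.

Lemma measurable_frobenius (m n : nat) (V : T -> 'M[R]_(m, n)) :
  (forall i j, measurable_fun setT (fun x => V x i j)) ->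
  measurable_fun setT (fun x => frobenius (V x)).
Proof.
move=> mV.
have -> : (fun x => frobenius (V x)) =
    (fun x => (\sum_i \sum_j V x i j * V x i j) `^ (2^-1)).
  by apply/funext => x; rewrite powR12_sqrt -mxinnerE// mxinner_ge0.
apply: (measurableT_comp (measurable_powR 2^-1)).
by apply: measurable_sum => i; apply: measurable_sum => j; exact: measurable_funM.
Qed.

Lemma measurable_frobenius_proj (m n : nat) (r : R) (V : T -> 'M[R]_(m, n)) :
  0 < r -> (forall i j, measurable_fun setT (fun x => V x i j)) ->
  measurable_fun setT
    ((fun x => frobenius_proj r (V x)) : T -> borel_mxType R m n).
Proof.
move=> r0 mV; apply/measurable_mxP => i j.
have -> : (fun x => frobenius_proj r (V x) i j) =
    (fun x => r * (Num.max r (frobenius (V x)))^-1 * V x i j).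
  by apply/funext => x; rewrite frobenius_projE// mxE.
apply: measurable_funM => //; apply: measurable_funM => //.
apply: measurable_funVr; first by move=> x; rewrite le_max ltW.
apply: measurable_maxr => //; exact: measurable_frobenius.
Qed.

End MeasurableStep.

Lemma measurable_noisy_step (R : realType) (D L N : nat)
    (C r G lambda eta0 : R) (Ds : prompts R D L N) : 0 < r ->
  measurable_fun setT
    ((fun u => noisy_step C r G lambda eta0 Ds u.1 u.2)
     : borel_mxType R D D * borel_mxType R D D -> borel_mxType R D D).
Proof.
move=> r0; apply: measurable_frobenius_proj => // i j.
pose mb := borel_mxType R D D.
have m1 k l : measurable_fun setT (fun u : mb * mb => (u.1 : 'M[R]_D) k l).
  exact: (measurableT_comp (measurable_mx_entry k l) measurable_fst).
have m2 k l : measurable_fun setT (fun u : mb * mb => (u.2 : 'M[R]_D) k l).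
  exact: (measurableT_comp (measurable_mx_entry k l) measurable_snd).
pose Z k := Ztilde C G (Ds k).
have -> : (fun u : mb * mb => ((1 - 2 * lambda * eta0) *: u.1
      - (eta0 / N%:R) *: (\sum_(k < N)
          (mxinner u.1 (Z k) - clip C (query_y (Ds k))) *: Z k)
      + u.2 : 'M[R]_D) i j) =
    (fun u : mb * mb => (1 - 2 * lambda * eta0) * (u.1 : 'M[R]_D) i j
      - (eta0 / N%:R) * (\sum_(k < N)
          ((\sum_i' \sum_j' (u.1 : 'M[R]_D) i' j' * Z k i' j')
            - clip C (query_y (Ds k))) * Z k i j)
      + (u.2 : 'M[R]_D) i j).
  apply/funext => u; rewrite !mxE summxE; congr (_ - _ * _ + _).
  by apply: eq_bigr => k _; rewrite mxE mxinnerE.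
apply: measurable_funD => //; apply: measurable_funB; first exact: measurable_funM.
apply: measurable_funM => //; apply: measurable_sum => k.
apply: measurable_funM => //; apply: measurable_funB => //.
by apply: measurable_sum => i'; apply: measurable_sum => j'; exact: measurable_funM.
Qed.

(** The projection is post-processing: composed with [h] it is just another test function [h']. What
    remains is a Gaussian vector whose mean moves by [a] when [Ds'] is replaced by [Ds]. *)
Lemma noisy_step_dp (R : realType) (D L N : nat) (C r G lambda eta0 sigma e dl v : R)
    (d : measure_display) (Omega : measurableType d) (P : probability Omega R)
    (z : Omega -> 'M[R]_D) (Ds Ds' : prompts R D L N) (Gamma : 'M[R]_D)
    (h : borel_mxType R D D -> \bar R) :
  (0 < N)%N -> 0 < C -> 0 < r -> 0 < G -> 0 < eta0 ->
  2 * G * (C + r * G) <= sigma -> 0 < e -> e <= 1 -> 0 < dl -> dl < 1 ->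
  v = 2 * eta0 ^+ 2 * (sigma ^+ 2 / (e ^+ 2 * N%:R ^+ 2)) * ln (5 / 4 / dl) ->
  isotropic_gaussian P v (fun w => mxvec (z w)) ->
  neighbors Ds Ds' -> frobenius Gamma <= r ->
  measurable_fun setT h -> (forall x, 0 <= h x <= 1)%E ->
  (\int[P]_w h (noisy_step C r G lambda eta0 Ds Gamma (z w)) <=
   (expR e)%:E * \int[P]_w h (noisy_step C r G lambda eta0 Ds' Gamma (z w))
   + dl%:E)%E.
Proof.
move=> N0 C0 r0 G0 eta00 hsigma e0 e1 dl0 dl1 vE Gz DD' Gr mh h01.
have NR : 0 < N%:R :> R by rewrite ltr0n.
have s0 : 0 < sigma.
  by apply: lt_le_trans hsigma; rewrite !mulr_gt0// addr_gt0// mulr_gt0.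
have l0 : 0 < ln (5 / 4 / dl).
  by apply: ln_gt0; rewrite ltr_pdivlMr// mul1r; lra.
have v0 : 0 < v by rewrite vE !mulr_gt0// ?invr_gt0 ?mulr_gt0 ?exprn_gt0.
pose m (E : prompts R D L N) := ridge_step C G lambda eta0 E Gamma.
pose a := mxvec (m Ds - m Ds').
pose q := \sum_j a 0%R j ^+ 2 / v.
have qE : q = frobenius (m Ds - m Ds') ^+ 2 / v.
  by rewrite /q -mulr_suml sum_mxvec_sqr.
have q0 : 0 <= q by rewrite qE divr_ge0 ?sqr_ge0// ltW.
have qe : q * (2 * ln (5 / 4 / dl)) <= e ^+ 2.
  have fs : frobenius (m Ds - m Ds') <= eta0 / N%:R * sigma.
    apply: (le_trans (frobenius_ridge_step_sub lambda C0 r0 G0 eta00 DD' Gr)).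
    by rewrite ler_pM2l// divr_gt0.
  have fs2 : frobenius (m Ds - m Ds') ^+ 2 <= (eta0 / N%:R * sigma) ^+ 2.
    by rewrite ler_pXn2r// ?nnegrE ?frobenius_ge0// mulr_ge0 ?divr_ge0// ltW.
  (* The variance is calibrated so that a shift of norm [eta0 / N%:R * sigma] meets the requirement
     of [gaussian_privacy_constant] with equality. *)
  have -> : e ^+ 2 = (eta0 / N%:R * sigma) ^+ 2 / v * (2 * ln (5 / 4 / dl)).
    by rewrite vE; field; rewrite !gt_eqF.
  by rewrite qE ler_pM2r ?mulr_gt0// ler_pM2r// invr_gt0.
have [p [kap [kap0 kapE kapdl]]] := gaussian_privacy_constant e0 e1 dl0 dl1 q0 qe.
pose h' (x : borel_mxType R 1 (D * D)) : \bar R :=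
  h (frobenius_proj r (m Ds' + vec_mx (x : 'rV[R]_(D * D)))).
have mh' : measurable_fun setT h'.
  apply: (measurableT_comp mh); apply: measurable_frobenius_proj => // i j.
  have -> : (fun x : borel_mxType R 1 (D * D) =>
      (m Ds' + vec_mx (x : 'rV[R]_(D * D))) i j) =
      (fun x => m Ds' i j + (x : 'rV[R]_(D * D)) 0 (mxvec_index i j)).
    by apply/funext => x; rewrite !mxE.
  by apply: measurable_funD => //; exact: measurable_mx_entry.
have := ge0_integral_gaussian_shift_le a e Gz v0 mh' (fun x => h01 _) kap0 kapE.
have shiftK (A B Z : 'M[R]_D) : A + (Z + (B - A)) = B + Z.
  by rewrite addrCA [A + _]addrC subrK addrC.
have hE w : h' (mxvec (z w) + a) = h (noisy_step C r G lambda eta0 Ds Gamma (z w)).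
  by rewrite /h' /a -linearD /= mxvecK shiftK.
have hE' w : h' (mxvec (z w)) = h (noisy_step C r G lambda eta0 Ds' Gamma (z w)).
  by rewrite /h' mxvecK.
under eq_integral do rewrite hE.
under [in X in (_ <= X)%E -> _]eq_integral do rewrite hE'.
by move=> /le_trans; apply; rewrite leeD2l// lee_fin.
Qed.

(** Each of the [T] steps receives the budget [(eps / T, delta / T)], for which [noise_variance] is
    calibrated. The hypothesis [hepsT] makes the budget [eps / T] of a step at most 1 and forces [T]
    to be positive. *)
Theorem theorem3p2 (R : realType) (D L N T : nat)
    (sigma eps delta C r G c lambda eta0 : R) (Gamma0 : 'M[R]_D)
    (d : measure_display) (Omega : measurableType d) (P : probability Omega R)
    (z : nat -> Omega -> 'M[R]_D)
    (hL : (0 < L)%N) (hN : (0 < N)%N)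
    (hC : 0 < C) (hr : 0 < r) (hG : 0 < G)
    (hc : 0 < c) (hlambda : c <= lambda) (heta0 : 0 < eta0)
    (heps : 0 < eps) (hepsT : eps <= T%:R)
    (hdelta0 : 0 < delta) (hdelta1 : delta < 1)
    (hGamma0 : frobenius Gamma0 <= r)
    (hz : noisy_head_noise N T sigma eps delta eta0 P z)
    (hsigma : 2 * G * (C + r * G) <= sigma) :
  in_context_dp P (@borel_mx R D D)
    (fun (Ds : prompts R D L N) (w : Omega) =>
       noisy_head T C r G lambda eta0 Gamma0 Ds (fun t => z t w))
    eps delta.
Proof.
have N0 : 0 < N%:R :> R by rewrite ltr0n.
have TR : 0 < T%:R :> R by exact: lt_le_trans hepsT.
have [hzG hzI] := hz.
have mz (t : 'I_T) : measurable_fun setT (z t : Omega -> borel_mxType R D D).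
  have [mzt _ _] := hzG t; apply/measurable_mxP => i j.
  by have := mzt (mxvec_index i j); under eq_fun do rewrite mxvecE.
(* The same noise, with values in the type of matrices that carries the Borel sigma-algebra. *)
pose zb : nat -> Omega -> borel_mxType R D D := z.
pose step (Ds : prompts R D L N) (x y : borel_mxType R D D) : borel_mxType R D D :=
  noisy_step C r G lambda eta0 Ds x y.
have headE (E : prompts R D L N) :
    (fun w => noisy_head T C r G lambda eta0 Gamma0 E (fun t => z t w)) =
    random_iter zb (step E) Gamma0 T.
  apply/funext => w; rewrite /noisy_head.
  suff H t : noisy_iter C r G lambda eta0 Gamma0 E (fun t => z t w) t =
      random_iter zb (step E) Gamma0 t w by exact: H.
  elim: t => [|t IH]; first by [].
  exact: (congr1 (fun x => noisy_step C r G lambda eta0 E x (z t w)) IH).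
move=> Ds Ds' DD' W mW.
have mstep (E : prompts R D L N) :
    measurable_fun setT (fun u : borel_mxType R D D * borel_mxType R D D =>
      step E u.1 u.2).
  exact: measurable_noisy_step.
have mhead (E : prompts R D L N) : measurable (random_iter zb (step E) Gamma0 T @^-1` W).
  rewrite -[X in measurable X]setTI.
  exact: (measurable_random_iter mz _ (mstep E) (leqnn T) measurableT mW).
pose h (x : borel_mxType R D D) : \bar R := (\1_W x)%:E.
have mh : measurable_fun setT h by apply/measurable_EFinP; exact: measurable_indic.
have h01 x : (0 <= h x <= 1)%E.
  by rewrite /h !lee_fin indicE; case: (x \in W); rewrite ?lexx ler01.
have PE (E : prompts R D L N) :
    P ((fun w => noisy_head T C r G lambda eta0 Gamma0 E (fun t => z t w)) @^-1` W) =
    (\int[P]_w h (random_iter zb (step E) Gamma0 T w))%E.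
  rewrite headE.
  transitivity (\int[P]_w (\1_(random_iter zb (step E) Gamma0 T @^-1` W) w)%:E)%E.
    by rewrite integral_indic// setIT.
  by apply: eq_integral => w _; rewrite /h !indicE.
rewrite !PE.
have dT0 : 0 < delta / T%:R by rewrite divr_gt0.
have T1 : 1 <= T%:R :> R by rewrite ler1n -(ltr0n R).
have dT1 : delta / T%:R < 1 by rewrite ltr_pdivrMr// mul1r; lra.
have eT0 : 0 < eps / T%:R by rewrite divr_gt0.
have eT1 : eps / T%:R <= 1 by rewrite ler_pdivrMr// mul1r.
(* The invariant set is the ball of radius [r]: it contains [Gamma0], and every step ends with a
   projection onto it. *)
have := @random_iter_dp _ _ _ Omega P (borel_mxType R D D) T z mz hzI
  (step Ds) (step Ds') Gamma0 [set x : 'M[R]_D | frobenius x <= r]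
  (eps / T%:R) (delta / T%:R) T h (mstep Ds) (mstep Ds') hGamma0 _ (ltW dT0) _
  (leqnn T) mh h01.
rewrite [T%:R * (eps / _)]mulrC divfK ?gt_eqF// [T%:R * (delta / _)]mulrC.
rewrite divfK ?gt_eqF//; apply; first by move=> x y; exact: frobenius_proj_le.
move=> t x k xr mk k01.
apply: (@noisy_step_dp R D L N C r G lambda eta0 sigma _ _
  (noise_variance N T sigma eps delta eta0)) => //.
have -> : 5 / 4 / (delta / T%:R) = 5 / 4 * T%:R / delta.
  by field; rewrite !gt_eqF.
rewrite /noise_variance; congr (_ * _ * _).
by field; rewrite !gt_eqF.
Qed.
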